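(* Let $\mathfrak g=(\mathfrak g_0\oplus\mathfrak g_{-1},d,[\cdot,\cdot],l_3)$ be a Lie $2$-algebra. For any $\Theta\in\mathrm{Der}^{-1}(\mathfrak g)=\mathrm{Hom}(\mathfrak g_0,\mathfrak g_{-1})$, $$\partial(e^{\Theta})=e^{\bar d(\Theta)},$$ i.e. the exponential maps $e:\mathrm{Der}^{-1}(\mathfrak g)\to\mathrm{Aut}^{-1}(\mathfrak g)$ and $e:\mathrm{Der}^{0}(\mathfrak g)\to\mathrm{Aut}^{0}(\mathfrak g)$ intertwine $\bar d:\mathrm{Der}^{-1}(\mathfrak g)\to\mathrm{Der}^0(\mathfrak g)$ and $\partial:\mathrm{Aut}^{-1}(\mathfrak g)\to\mathrm{Aut}^0(\mathfrak g)$.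
   Context: All vector spaces are real and finite-dimensional. A Lie $2$-algebra $\mathfrak g=(\mathfrak g_0\oplus\mathfrak g_{-1},d,[\cdot,\cdot],l_3)$ consists of vector spaces $\mathfrak g_0,\mathfrak g_{-1}$, a linear map $d:\mathfrak g_{-1}\to\mathfrak g_0$, a skew-symmetric bilinear bracket with $[x,y]\in\mathfrak g_0$, $[x,a]=-[a,x]\in\mathfrak g_{-1}$, $[a,b]=0$ for $x,y\in\mathfrak g_0$, $a,b\in\mathfrak g_{-1}$, and a skew-symmetric trilinear map $l_3:\wedge^3\mathfrak g_0\to\mathfrak g_{-1}$ such that for all $x,y,z,x_i\in\mathfrak g_0$, $a,b\in\mathfrak g_{-1}$: (a) $d[x,a]=[x,da]$, $[da,b]=[a,db]$; (b) $[[x,y],z]+[[y,z],x]+[[z,x],y]=-dl_3(x,y,z)$, $[[x,y],a]+[[y,a],x]+[[a,x],y]=-l_3(x,y,da)$; (c) $\sum_{i=1}^4(-1)^{i+1}[x_i,l_3(x_1,\dots,\hat x_i,\dots,x_4)]+\sum_{i<j}(-1)^{i+j}l_3([x_i,x_j],x_1,\dots,\hat x_i,\dots,\hat x_j,\dots,x_4)=0$. $\mathrm{Aut}^0(\mathfrak g)$ is the group of triples $(A_0,A_1,A_2)$, $A_0\in GL(\mathfrak g_0)$, $A_1\in GL(\mathfrak g_{-1})$, $A_0d=dA_1$, $A_2:\wedge^2\mathfrak g_0\to\mathfrak g_{-1}$, with $A_0[x,y]-[A_0x,A_0y]=dA_2(x,y)$, $A_1[x,a]-[A_0x,A_1a]=A_2(x,da)$,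 $[A_0x,A_2(y,z)]+c.p.+l_3(A_0x,A_0y,A_0z)=A_2([x,y],z)+c.p.+A_1l_3(x,y,z)$ ($c.p.$: remaining cyclic permutations of $x,y,z$). $\mathrm{Aut}^{-1}(\mathfrak g)$ is the group of units of $\mathrm{Hom}(\mathfrak g_0,\mathfrak g_{-1})$ with product $\tau\star\tau'=\tau+\tau'+\tau\circ d\circ\tau'$. The map $\partial$ is $\partial(\tau)=(I+d\circ\tau,I+\tau\circ d,l_\tau)$ with $l_\tau(x,y)=\tau[x,y]-[x,\tau y]-[\tau x,y]-[\tau x,d\tau y]$. $\mathrm{Der}^0(\mathfrak g)$ is the set of triples $(X_0,X_1,l_X)$ with $X_0\in\mathrm{End}(\mathfrak g_0)$, $X_1\in\mathrm{End}(\mathfrak g_{-1})$, $X_0\circ d=d\circ X_1$, $l_X:\wedge^2\mathfrak g_0\to\mathfrak g_{-1}$ linear, $dl_X(x,y)=X_0[x,y]-[X_0x,y]-[x,X_0y]$, $l_X(x,da)=X_1[x,a]-[X_0x,a]-[x,X_1a]$, $X_1l_3(x,y,z)=\big(l_X(x,[y,z])+[x,l_X(y,z)]+l_3(X_0x,y,z)\big)+c.p.(x,y,z)$. The map $\bar d$ is $\bar d(\Theta)=(d\circ\Theta,\Theta\circ d,l_{\delta(\Theta)})$ with $l_{\delta(\Theta)}(x,y)=\Theta[x,y]-[x,\Theta y]-[\Theta x,y]$. The exponential maps are: for $\Theta\in\mathrm{Der}^{-1}(\mathfrak g)$, $e^\Theta=\sum_{n\ge1}\frac{1}{n!}(\Theta\circ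 d)^{n-1}\circ\Theta$; for $(X_0,X_1,l_X)\in\mathrm{Der}^0(\mathfrak g)$, $e^{(X_0,X_1,l_X)}=(e^{X_0},e^{X_1},e^{l_X})$ with $e^{X_i}$ the usual exponential and $e^{l_X}(x,y)=\sum_{n\ge1}\frac1{n!}\sum_{i+j+k=n-1,\ i,j,k\ge0}\binom{i+j}{i}X_1^k\,l_X(X_0^ix,X_0^jy)$. *)

(* Defs.v *)
From HB Require Import structures.
From mathcomp Require Import all_boot all_order all_algebra.
From mathcomp Require Import all_classical all_reals all_analysis.
Set Implicit Arguments.
Unset Strict Implicit.
Unset Printing Implicit Defensive.
Import Order.TTheory GRing.Theory Num.Theory.
Import numFieldNormedType.Exports.
Local Open Scope ring_scope.

(* Elements of /\^2 U -> V and /\^3 U -> V are represented by skew-symmetric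
   multilinear functions. *)
Definition skew2 (R : realType) (U V : vectType R) (f : U -> U -> V) : Prop :=
  [/\ forall y, linear (f^~ y),
      forall x, linear (f x) &
      forall x y, f y x = - f x y].

(* br00 is [x, y], br01 is [x, a] and br10 is [a, x] for x, y of degree 0 and
   a of degree -1; the bracket of two elements of degree -1 is zero and does
   not appear.  Multilinearity is carried by the curried Hom types. *)
Record lie2alg (R : realType) := Lie2Alg {
  deg0 : vectType R;
  degm1 : vectType R;
  dmap : 'Hom(degm1, deg0);
  br00 : 'Hom(deg0, 'End(deg0));
  br01 : 'Hom(deg0, 'End(degm1));
  l3 : 'Hom(deg0, 'Hom(deg0, 'Hom(deg0, degm1)));
  br10 (a : degm1) (x : deg0) : degm1 := - br01 x a;
  br00_skew : forall x y, br00 y x = - br00 x y;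
  l3_skew12 : forall x y z, l3 y x z = - l3 x y z;
  l3_skew23 : forall x y z, l3 x z y = - l3 x y z;
  dmap_br : forall x a, dmap (br01 x a) = br00 x (dmap a);
  br_dmap : forall a b, br01 (dmap a) b = br10 a (dmap b);
  jacobi0 : forall x y z,
    br00 (br00 x y) z + br00 (br00 y z) x + br00 (br00 z x) y
    = - dmap (l3 x y z);
  jacobi1 : forall x y a,
    br01 (br00 x y) a + br10 (br01 y a) x + br10 (br10 a x) y
    = - l3 x y (dmap a);
  l3_coherence : forall x1 x2 x3 x4,
    (br01 x1 (l3 x2 x3 x4) - br01 x2 (l3 x1 x3 x4)
     + br01 x3 (l3 x1 x2 x4) - br01 x4 (l3 x1 x2 x3))
    + (- l3 (br00 x1 x2) x3 x4 + l3 (br00 x1 x3) x2 x4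
       - l3 (br00 x1 x4) x2 x3 - l3 (br00 x2 x3) x1 x4
       + l3 (br00 x2 x4) x1 x3 - l3 (br00 x3 x4) x1 x2) = 0
}.

(* Series in a finite-dimensional space V, for its unique Hausdorff vector space
   topology, computed in coordinates in the topological space
   'rV[R]_(\dim {:V}).  vseries is meaningful only under vseries_cvg. *)
Definition coords (R : realType) (V : vectType R) (v : V) :
  'rV[R]_(\dim {:V}) := passmx.rVof (vbasis {:V}) v.

Definition vseries_cvg (R : realType) (V : vectType R) (u : nat -> V) : Prop :=
  cvgn (series (fun n => coords (u n))).

Definition vseries (R : realType) (V : vectType R) (u : nat -> V) : V :=
  passmx.vecof (vbasis {:V}) (limn (series (fun n => coords (u n)))).

Definition end_pow (R : realType) (V : vectType R) (X : 'End(V)) (n : nat) :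
  'End(V) := iter n (comp_lfun X) \1%VF.

Definition exp_end_term (R : realType) (V : vectType R) (X : 'End(V))
  (n : nat) : 'End(V) := (n`!%:R)^-1 *: end_pow X n.

Definition exp_end (R : realType) (V : vectType R) (X : 'End(V)) : 'End(V) :=
  vseries (exp_end_term X).

Section Lie2.
Variables (R : realType) (g : lie2alg R).

Local Notation g0 := (deg0 g).
Local Notation g1 := (degm1 g).
Local Notation d := (dmap g).
Local Notation "[ x , y ]00" := (br00 g x y) (format "[ x ,  y ]00").
Local Notation "[ x , a ]01" := (br01 g x a) (format "[ x ,  a ]01").
Local Notation "[ a , x ]10" := (@br10 R g a x) (format "[ a ,  x ]10").

(* Der^0 and Aut^0 are subsets, given by is_der0 and is_aut0, of one type of
   triples. *)
Record triple := Triple {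
  t0 : 'End(g0);
  t1 : 'End(g1);
  t2 : g0 -> g0 -> g1
}.

Definition derm1 := 'Hom(g0, g1).

Definition is_der0 (X : triple) : Prop :=
  [/\ (t0 X \o d = d \o t1 X)%VF,
      skew2 (t2 X),
      forall x y, d (t2 X x y)
        = t0 X [x, y]00 - [t0 X x, y]00 - [x, t0 X y]00,
      forall x a, t2 X x (d a)
        = t1 X [x, a]01 - [t0 X x, a]01 - [x, t1 X a]01 &
      forall x y z,
        let T x y z :=
          t2 X x [y, z]00 + [x, t2 X y z]01 + l3 g (t0 X x) y z in
        t1 X (l3 g x y z) = T x y z + T y z x + T z x y].

Definition is_aut0 (A : triple) : Prop :=
  [/\ bijective (t0 A) /\ bijective (t1 A),
      (t0 A \o d = d \o t1 A)%VF /\ skew2 (t2 A),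
      forall x y, t0 A [x, y]00 - [t0 A x, t0 A y]00 = d (t2 A x y),
      forall x a, t1 A [x, a]01 - [t0 A x, t1 A a]01 = t2 A x (d a) &
      forall x y z,
        [t0 A x, t2 A y z]01 + [t0 A y, t2 A z x]01 + [t0 A z, t2 A x y]01
        + l3 g (t0 A x) (t0 A y) (t0 A z)
        = t2 A [x, y]00 z + t2 A [y, z]00 x + t2 A [z, x]00 y
          + t1 A (l3 g x y z)].

Definition star (tau tau' : 'Hom(g0, g1)) : 'Hom(g0, g1) :=
  tau + tau' + (tau \o d \o tau')%VF.

(* 0 is the neutral element of star. *)
Definition is_autm1 (tau : 'Hom(g0, g1)) : Prop :=
  exists tau', star tau tau' = 0 /\ star tau' tau = 0.

Definition partial (tau : 'Hom(g0, g1)) : triple :=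
  Triple (\1 + (d \o tau))%VF (\1 + (tau \o d))%VF
    (fun x y => tau [x, y]00 - [x, tau y]01 - [tau x, y]10
                - [tau x, d (tau y)]10).

Definition dbar (theta : derm1) : triple :=
  Triple (d \o theta)%VF (theta \o d)%VF
    (fun x y => theta [x, y]00 - [x, theta y]01 - [theta x, y]10).

(* In the next two families the index n stands for n - 1 in the usual sums
   over n >= 1. *)
Definition expm1_term (theta : derm1) (n : nat) : 'Hom(g0, g1) :=
  (n.+1`!%:R)^-1 *: (end_pow (theta \o d) n \o theta)%VF.

Definition exp_l_term (X : triple) (x y : g0) (n : nat) : g1 :=
  (n.+1`!%:R)^-1 *:
    \sum_(i < n.+1) \sum_(j < n.+1) \sum_(k < n.+1 | (i + j + k == n)%N)
      'C(i + j, i)%:R *: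
        end_pow (t1 X) k (t2 X (end_pow (t0 X) i x) (end_pow (t0 X) j y)).

Definition expm1 (theta : derm1) : 'Hom(g0, g1) := vseries (expm1_term theta).

Definition exp0 (X : triple) : triple :=
  Triple (exp_end (t0 X)) (exp_end (t1 X))
    (fun x y => vseries (exp_l_term X x y)).

Definition expm1_cvg (theta : derm1) : Prop := vseries_cvg (expm1_term theta).

Definition exp0_cvg (X : triple) : Prop :=
  [/\ vseries_cvg (exp_end_term (t0 X)), vseries_cvg (exp_end_term (t1 X)) &
      forall x y, vseries_cvg (exp_l_term X x y)].

End Lie2.

(* Main.v *)
Require Import Defs.
From mathcomp Require Import all_boot all_order all_algebra.
From mathcomp Require Import all_classical all_reals all_analysis.
From HB Require Import structures.
From mathcomp Require Import ring lra.

(* With [X0 = d theta], [X1 = theta d] and [tau_n = X1^(n-1) theta]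
   ([tau_0 = 0]), the n-th term of the series for [e^l (x, y)], without the
   factor [1 / n!], is, by induction on n and Pascal's rule,
     [tau_n [x, y] - [x, tau_n y] + \sum_i 'C(n, i) [X0^i y, tau_(n-i) x]].
   The last sum is n! times a term of the Cauchy product of [e^X0 y] and
   [e^theta x], and [e^X0 = 1 + d e^theta], so the series sums to
   [l_tau (x, y)] for [tau = e^theta].  A Cauchy product also shows that
   [e^(- theta)] inverts [e^theta] for [star], and [partial] of a unit is an
   automorphism by the Jacobi identities. *)

Set Implicit Arguments.
Unset Strict Implicit.
Unset Printing Implicit Defensive.
Import Order.TTheory GRing.Theory Num.Theory.
Import numFieldNormedType.Exports.
Local Open Scope classical_set_scope.
Local Open Scope ring_scope.

(** * Cauchy products of absolutely convergent real series *)

(** Both sides run over the triangle [i + j < N], on the left by its antidiagonals [n = i + j]. *)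
Lemma sum_antidiagonal (V : nmodType) (G : nat -> nat -> V) (N : nat) :
  \sum_(n < N) \sum_(i < n.+1) G i (n - i)%N =
  \sum_(i < N) \sum_(j < N | (i + j < N)%N) G i j.
Proof.
transitivity (\sum_(n < N) \sum_(i < N | (i <= n)%N) G i (n - i)%N).
  apply: eq_bigr => n _.
  by rewrite (big_ord_widen N (fun i => G i (n - i)%N)).
rewrite (exchange_big_dep xpredT) //=; apply: eq_bigr => i _.
transitivity (\sum_(0 <= j < N - i) G i j); last first.
  rewrite big_mkord (big_ord_widen N) ?leq_subr//.
  by apply: eq_bigl => j; rewrite ltn_subRL.
transitivity (\sum_(i <= j < N) G i (j - i)%N).
  by rewrite (big_nat_widenl _ 0%N) // big_mkord.
rewrite -{1}(add0n (val i)) big_addn.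
by apply: eq_bigr => j _; rewrite addnK.
Qed.

Lemma cvg_half : half n @[n --> \oo] --> \oo.
Proof.
move=> A [n _ nA]; exists n.*2 => // m /= nm; apply: nA => /=.
by rewrite -(doubleK n); exact: half_leq.
Qed.

(** The product of partial sums runs over a square, the Cauchy product over a triangle that contains
    the square of half the side. The difference is thus at most [P N - P N./2], where [P] is the
    product of the absolute partial sums, and this tends to 0 because [P] converges. *)
Lemma cauchy_product (R : realType) (a b : R^nat) (A B : R) :
  cvgn [normed series a] -> cvgn [normed series b] ->
  series a @ \oo --> A -> series b @ \oo --> B ->
  series (fun n => \sum_(i < n.+1) a i * b (n - i)%N) @ \oo --> A * B.
Proof.
move=> na nb aA bB.
pose P := fun n => [normed series a] n * [normed series b] n.
have cP : P @ \oo --> limn [normed series a] * limn [normed series b].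
  by apply: cvgM.
have cPd : (fun n => P n - P n./2) @ \oo --> (0 : R).
  rewrite -(subrr (limn [normed series a] * limn [normed series b])).
  apply: cvgB => //.
  exact: (cvg_comp _ _ cvg_half cP).
have cE : (fun n => series a n * series b n -
    series (fun n => \sum_(i < n.+1) a i * b (n - i)%N) n) @ \oo --> (0 : R).
  apply/norm_cvg0P; apply: (squeeze_cvgr _ (cvg_cst 0) cPd).
  apply: nearW => N; rewrite normr_ge0 /=.
  have le2N : (N./2 <= N)%N by rewrite leq_half_double -addnn -addnS leq_addr.
  rewrite !seriesEord /= (sum_antidiagonal (fun i j => a i * b j)).
  have E (f g : R^nat) n : (\sum_(i < n) f i) * (\sum_(j < n) g j) =
      \sum_(i < n) \sum_(j < n) f i * g j.
    by rewrite mulr_suml; apply: eq_bigr => i _; rewrite mulr_sumr.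
  rewrite E -sumrB.
  under eq_bigr => i _ do
    rewrite (bigID (fun j : 'I_N => (i + j < N)%N)) /= addrAC subrr add0r.
  apply: le_trans (ler_norm_sum _ _ _) _.
  rewrite /P /normed_series_of /series /= !big_mkord.
  have En n : (\sum_(i < n) `|a i|) * (\sum_(j < n) `|b j|) =
    \sum_(i < n) \sum_(j < n) `|a i| * `|b j|.
    exact: (E (fun k => `|a k|) (fun k => `|b k|)).
  rewrite !En.
  (* It remains to fit the square of side [N./2] and the complement of the triangle, which are
     disjoint, into the square of side [N]. *)
  rewrite lerBrDl.
  have -> : \sum_(i < N./2) \sum_(j < N./2) `|a i| * `|b j| =
      \sum_(i < N | (i < N./2)%N) \sum_(j < N | (j < N./2)%N) `|a i| * `|b j|.
    rewrite -(big_ord_widen _ (fun i => \sum_(j < N | (j < N./2)%N) `|a i| * `|b j|)) //.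
    apply: eq_bigr => i _.
    by rewrite -(big_ord_widen _ (fun j => `|a i| * `|b j|)).
  rewrite [X in X + _ <= _]big_mkcond /= -big_split /=; apply: ler_sum => i _.
  apply: (@le_trans _ _ (\sum_(j < N | (i < N./2)%N && (j < N./2)%N) `|a i| * `|b j|
    + \sum_(j < N | ~~ (i + j < N)%N) `|a i| * `|b j|)).
    apply: lerD; last first.
      apply: le_trans (ler_norm_sum _ _ _) _.
      by apply: ler_sum => j _; rewrite normrM.
    by case: ifP => _ //=; rewrite big_pred0.
  rewrite [leRHS](bigID (fun j : 'I_N => (i + j < N)%N)) /= lerD2r.
  rewrite [leLHS]big_mkcond [leRHS]big_mkcond; apply: ler_sum => j _.
  case: ifP => [/andP[h1 h2]|_]; last by case: ifP => // _; rewrite mulr_ge0.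
  rewrite ifT //.
  apply: (@leq_trans (N./2 + N./2)%N); first by rewrite -addSn leq_add // ltnW.
  by rewrite addnn -[leqRHS]odd_double_half leq_addl.
rewrite -[A * B]subr0.
have -> : series (fun n => \sum_(i < n.+1) a i * b (n - i)%N) =
    series a * series b - (fun n => series a n * series b n -
      series (fun n => \sum_(i < n.+1) a i * b (n - i)%N) n).
  by apply/funext => n; rewrite !fctE subKr.
by apply: cvgB cE; exact: cvgM.
Qed.

Lemma cvg_sum_ord (R : realType) (n : nat) (f : 'I_n -> R^nat) (l : 'I_n -> R) :
  (forall i, f i @ \oo --> l i) ->
  (fun N => \sum_(i < n) f i N) @ \oo --> \sum_(i < n) l i.
Proof. by move=> fl; apply: cvg_big => //; exact: add_continuous. Qed.

(** * Series in finite-dimensional spaces, tested against functionals *)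

Section VSeries.
Variable R : realType.
Implicit Types U V W : vectType R.

(* Quantifying over functionals makes images under linear maps immediate. *)
Definition vsums V (u : nat -> V) (s : V) : Prop :=
  forall phi : {scalar V}, series (fun n => phi (u n)) @ \oo --> phi s.

Definition vabs V (u : nat -> V) : Prop :=
  forall phi : {scalar V}, cvgn [normed series (fun n => phi (u n))].

Lemma scalar_coord V (phi : {scalar V}) (v : V) :
  phi v = \sum_(i < \dim {:V}) coord (vbasis {:V}) i v * phi (vbasis {:V})`_i.
Proof.
rewrite {1}(coord_vbasis (memvf v)) linear_sum.
by apply: eq_bigr => i _; rewrite linearZ.
Qed.

Lemma coord_series V (u : nat -> V) (i : 'I_(\dim {:V})) n :
  series (fun n => coords (u n)) n 0 i =
  series (fun n => coord (vbasis {:V}) i (u n)) n.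
Proof.
by rewrite /series /= summxE; apply: eq_bigr => k _; rewrite !mxE.
Qed.

(** The coordinates are finitely many functionals, so convergence against functionals gives
    entrywise convergence of [coords]. *)
Lemma vsums_vseries V (u : nat -> V) (s : V) :
  vsums u s -> vseries_cvg u /\ vseries u = s.
Proof.
move=> us.
have c : series (fun n => coords (u n)) @ \oo --> coords s.
  move=> A [P Ps sPA].
  have F : \forall n \near \oo, forall ij : 'I_1 * 'I_(\dim {:V}),
      P ij.1 ij.2 (series (fun n => coords (u n)) n ij.1 ij.2).
    apply: filter_forall => -[i j] /=.
    have := us (coord (vbasis {:V}) j : {scalar V}).
    have := Ps i j; rewrite ord1 mxE => Psj /(_ _ Psj) h.
    have {h} [N _ hN] := h; exists N => // n /hN /=.
    by rewrite coord_series.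
  by apply: filterS F => n Fn; apply: sPA => i j; exact: (Fn (i, j)).
have cc : vseries_cvg u by apply/cvg_ex; exists (coords s).
split=> //; rewrite /vseries -[RHS](passmx.rVofK (vbasisP {:V})).
congr passmx.vecof; apply/rowP => i.
apply: (@cvg_unique _ (@Rhausdorff R)
  (fmap (fun n => series (fun n => coords (u n)) n 0 i) \oo)).
  exact: cvg_comp cc (@coord_continuous R 1 (\dim {:V}) 0 i _).
exact: cvg_comp c (@coord_continuous R 1 (\dim {:V}) 0 i _).
Qed.

(** The sum is assembled from the limits of the coordinates; every functional is a finite
    combination of these. *)
Lemma vabs_vsums V (u : nat -> V) : vabs u -> exists s, vsums u s.
Proof.
move=> ua.
pose l i := limn (series (fun n => coord (vbasis {:V}) i (u n))).
exists (\sum_(i < \dim {:V}) l i *: (vbasis {:V})`_i) => phi.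
rewrite linear_sum /=.
have -> : series (fun n => phi (u n)) = fun N =>
    \sum_(i < \dim {:V}) series (fun n => coord (vbasis {:V}) i (u n)) N
      * phi (vbasis {:V})`_i.
  apply/funext => N; rewrite /series /=.
  under eq_bigr => k _ do rewrite scalar_coord.
  by rewrite exchange_big /=; apply: eq_bigr => i _; rewrite mulr_suml.
apply: cvg_sum_ord => i; rewrite linearZ /=; apply: cvgM; last exact: cvg_cst.
exact: normed_cvg (ua _).
Qed.

Lemma vsums_vseriesE V (u : nat -> V) : vabs u -> vsums u (vseries u).
Proof. by case/vabs_vsums => s us; have [_ ->] := vsums_vseries us. Qed.

Lemma eq_vsums V (u v : nat -> V) s : u =1 v -> vsums u s -> vsums v s.
Proof. by move=> /funext ->. Qed.

Lemma vsums_unique V (u : nat -> V) s t : vsums u s -> vsums u t -> s = t.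
Proof.
by move=> /vsums_vseries[_ <-] /vsums_vseries[_ <-].
Qed.

Lemma vsums_linear U V (f : {linear U -> V}) (u : nat -> U) s :
  vsums u s -> vsums (fun n => f (u n)) (f s).
Proof. by move=> us phi; exact: (us (phi \o f : {scalar U})). Qed.

Lemma vabs_linear U V (f : {linear U -> V}) (u : nat -> U) :
  vabs u -> vabs (fun n => f (u n)).
Proof. by move=> us phi; exact: (us (phi \o f : {scalar U})). Qed.

Lemma vsumsD V (u v : nat -> V) s t :
  vsums u s -> vsums v t -> vsums (fun n => u n + v n) (s + t).
Proof.
move=> us vt phi; rewrite linearD.
have -> : (fun n => phi (u n + v n)) = (fun n => phi (u n)) + (fun n => phi (v n)).
  by apply/funext => n; rewrite linearD.
by rewrite seriesD; apply: cvgD.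
Qed.

Lemma vsumsB V (u v : nat -> V) s t :
  vsums u s -> vsums v t -> vsums (fun n => u n - v n) (s - t).
Proof. by move=> us /(vsums_linear (f := -%R)) vt; exact: vsumsD us vt. Qed.

(** Passes between series starting at [n = 0] and the families [expm1_term] and [exp_l_term], whose
    index is shifted by one. *)
Lemma vsums_shift V (u : nat -> V) s :
  vsums u s <-> vsums (fun n => u n.+1) (s - u 0%N).
Proof.
suff H (phi : {scalar V}) : (series (fun n => phi (u n)) @ \oo --> phi s) =
    (series (fun n => phi (u n.+1)) @ \oo --> phi (s - u 0%N)).
  by split => us phi; have := us phi; rewrite H.
rewrite -cvg_shiftS.
have -> : [sequence series (fun n => phi (u n)) n.+1]_n =
    (fun n => phi (u 0%N) + series (fun n => phi (u n.+1)) n).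
  by apply/funext => n; rewrite /series /= big_nat_recl.
rewrite linearB /= propeqE; split => h; last first.
  by rewrite -(subrKC (phi (u 0%N)) (phi s)); apply: cvgD h; exact: cvg_cst.
have -> : series (fun n => phi (u n.+1)) = (fun n => phi (u 0%N) +
    series (fun n => phi (u n.+1)) n) - cst (phi (u 0%N)).
  by apply/funext => n; rewrite !fctE addrC addKr.
by apply: cvgB h _; exact: cvg_cst.
Qed.

Lemma vabs_shift V (u : nat -> V) : vabs (fun n => u n.+1) -> vabs u.
Proof.
move=> us phi; have /cvg_ex[l ul] := us phi.
apply/cvg_ex; exists (`|phi (u 0%N)| + l); rewrite -cvg_shiftS.
have -> : [sequence [normed series (fun n => phi (u n))] n.+1]_n =
    cst `|phi (u 0%N)| + [normed series (fun n => phi (u n.+1))].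
  by apply/funext => n; rewrite /= /series /= big_nat_recl.
by apply: cvgD ul; exact: cvg_cst.
Qed.

(** In bases, [phi (B x y)] is a finite combination of products of coordinates, and each product is
    a Cauchy product of real series. *)
Lemma vsums_bilinear U V W (B : 'Hom(U, 'Hom(V, W))) (u : nat -> U)
    (v : nat -> V) s t :
  vabs u -> vabs v -> vsums u s -> vsums v t ->
  vsums (fun n => \sum_(i < n.+1) B (u i) (v (n - i)%N)) (B s t).
Proof.
move=> ua va us vt phi.
pose c i j := phi (B (vbasis {:U})`_i (vbasis {:V})`_j).
have E x y : phi (B x y) = \sum_(i < \dim {:U}) \sum_(j < \dim {:V})
    coord (vbasis {:U}) i x * coord (vbasis {:V}) j y * c i j.
  rewrite {1}(coord_vbasis (memvf x)) linear_sum sum_lfunE linear_sum.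
  apply: eq_bigr => i _; rewrite linearZ scale_lfunE linearZ /=.
  rewrite {1}(coord_vbasis (memvf y)) !linear_sum /= mulr_sumr.
  by apply: eq_bigr => j _; rewrite !linearZ /= mulrA.
pose w i j n := \sum_(k < n.+1)
  coord (vbasis {:U}) i (u k) * coord (vbasis {:V}) j (v (n - k)%N).
have -> : series (fun n => phi (\sum_(i < n.+1) B (u i) (v (n - i)%N))) =
    fun N => \sum_(i < \dim {:U}) \sum_(j < \dim {:V}) series (w i j) N * c i j.
  apply/funext => N; rewrite /series /=.
  under [RHS]eq_bigr => i _ do under eq_bigr => j _ do rewrite mulr_suml.
  under [RHS]eq_bigr => i _ do rewrite exchange_big /=.
  rewrite exchange_big /=; apply: eq_bigr => n _.
  rewrite linear_sum /=.
  under eq_bigr => k _ do rewrite E.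
  rewrite exchange_big /=; apply: eq_bigr => i _.
  rewrite exchange_big /=; apply: eq_bigr => j _.
  by rewrite mulr_suml.
rewrite E; apply: cvg_sum_ord => i; apply: cvg_sum_ord => j.
apply: cvgM; last exact: cvg_cst.
exact: (cauchy_product (ua (coord (vbasis {:U}) i : {scalar U}))
  (va (coord (vbasis {:V}) j : {scalar V}))
  (us _) (vt _)).
Qed.

(** If [f] has bound [M] for the coordinate l1 norm [N], the terms are dominated by a multiple of
    [M ^+ n / n!]. An upper bound on [c] also covers the coefficients [1 / (n + 1)!] of
    [expm1_term]. *)
Lemma vabs_exp V (f : {linear V -> V}) (v : V) (c : R^nat) :
  (forall n, `|c n| <= (n`!%:R)^-1) -> vabs (fun n => c n *: iter n f v).
Proof.
move=> c_le phi.
pose N (v : V) : R := \sum_(i < \dim {:V}) `|coord (vbasis {:V}) i v|.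
have bound (psi : {scalar V}) w :
    `|psi w| <= N w * \sum_(i < \dim {:V}) `|psi (vbasis {:V})`_i|.
  rewrite scalar_coord (le_trans (ler_norm_sum _ _ _)) // mulr_suml.
  apply: ler_sum => i _; rewrite normrM ler_wpM2l //.
  by rewrite (bigD1 i) //= lerDl sumr_ge0.
have [M M0 HM] : exists2 M : R, 0 <= M & forall w, N (f w) <= M * N w.
  (* [M] is the sum of the absolute values of the matrix entries of [f]. *)
  exists (\sum_(i < \dim {:V}) \sum_(j < \dim {:V})
      `|coord (vbasis {:V}) i (f (vbasis {:V})`_j)|).
    by apply: sumr_ge0 => i _; apply: sumr_ge0.
  move=> w; rewrite {1}/N mulr_suml; apply: ler_sum => i _.
  by rewrite mulrC; exact: (bound (coord (vbasis {:V}) i \o f : {scalar V})).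
have HN n : N (iter n f v) <= M ^+ n * N v.
  elim: n => [|n IH]; first by rewrite mul1r.
  by rewrite iterS (le_trans (HM _)) // exprS -mulrA ler_wpM2l.
have [C [C0 HC]] : exists C : R, 0 <= C /\ forall w, `|phi w| <= C * N w.
  exists (\sum_(i < \dim {:V}) `|phi (vbasis {:V})`_i|).
  by split; [exact: sumr_ge0 | move=> w; rewrite mulrC].
apply: (@series_le_cvg _ _ ((C * N v) *: exp_coeff M)).
- by move=> n /=; exact: normr_ge0.
- move=> n; apply: mulr_ge0; last exact: exp_coeff_ge0.
  by rewrite mulr_ge0 // sumr_ge0.
- move=> n /=; rewrite linearZ /= normrM.
  have -> : ((C * N v) *: exp_coeff M) n = C * N v * M ^+ n / n`!%:R.
    by rewrite -mulrA.
  rewrite mulrC; apply: ler_pM => //.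
  by rewrite (le_trans (HC _)) // -mulrA ler_wpM2l // mulrC.
- by apply: is_cvg_seriesZ; exact: is_cvg_series_exp_coeff.
Qed.

End VSeries.

(* Testing against functionals turns identities between vectors into linear
   arithmetic over [R], which [lra] decides. *)
Lemma eq_scalar (R : realType) (V : vectType R) (u v : V) :
  (forall phi : {scalar V}, phi u = phi v) -> u = v.
Proof.
move=> uv; rewrite (coord_vbasis (memvf u)) (coord_vbasis (memvf v)).
by apply: eq_bigr => i _; rewrite (uv (coord (vbasis {:V}) i : {scalar V})).
Qed.

(* The generic [linearD], [linearN] and [linearZ] would also rewrite with the
   opposite seen as a linear map. *)
Lemma lfun_linearE (R : realType) (U V : vectType R) (f : 'Hom(U, V)) :
  ((forall x y, f (x + y) = f x + f y)%R * (forall x, f (- x) = - f x)%R *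
   (forall a x, f (a *: x) = a *: f x)%R)%type.
Proof. by split; first split; move=> *; rewrite ?(linearD, linearN, linearZ). Qed.

Lemma scalar_linearE (R : realType) (V : vectType R) (phi : {scalar V}) :
  ((forall x y, phi (x + y) = phi x + phi y)%R * (forall x, phi (- x) = - phi x)%R *
   (forall a x, phi (a *: x) = a * phi x)%R)%type.
Proof. by split; first split; move=> *; rewrite ?(linearD, linearN, linearZ). Qed.

Ltac lin phi := rewrite ?(comp_lfunE, id_lfunE, add_lfunE, opp_lfunE, scale_lfunE,
  lfun_linearE, scalar_linearE phi).

(** * Derivations from [dbar] and automorphisms from [partial] *)

Section Algebra.
Variables (R : realType) (g : lie2alg R).
Local Notation g0 := (deg0 g).
Local Notation g1 := (degm1 g).
Local Notation d := (dmap g).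
Local Notation br := (br00 g).
Local Notation ac := (br01 g).

Lemma ac_dmap (a b : g1) : ac (d a) b = - ac (d b) a.
Proof. exact: br_dmap. Qed.

(** [jacobi1] solved for the action of a bracket: [l3] measures how far [ac] is from a
    representation. *)
Lemma ac_br (x y : g0) (a : g1) :
  ac (br x y) a = ac x (ac y a) - ac y (ac x a) - l3 g x y (d a).
Proof.
by rewrite -jacobi1 /br10 linearN opprK; apply: eq_scalar => phi; lin phi; ring.
Qed.

Lemma l3_cycle (x y z : g0) : l3 g x y z = l3 g y z x.
Proof. by rewrite l3_skew12 [in RHS]l3_skew23. Qed.

Lemma is_der0_dbar (theta : derm1 g) : is_der0 (dbar theta).
Proof.
rewrite /dbar; split => /=.
- by rewrite comp_lfunA.
- split=> [y a x x'|x a y y'|x y]; rewrite /br10.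
  + by apply: eq_scalar => phi; lin phi; ring.
  + by apply: eq_scalar => phi; lin phi; ring.
  + by rewrite (br00_skew x y); apply: eq_scalar => phi; lin phi; ring.
- move=> x y; rewrite /br10; apply: eq_scalar => phi; lin phi.
  by rewrite !dmap_br (br00_skew y (d _)); lin phi; ring.
- move=> x a; rewrite /br10; apply: eq_scalar => phi; lin phi.
  by rewrite dmap_br (ac_dmap a); lin phi; ring.
- move=> x y z; rewrite /br10.
  rewrite (br00_skew (br y z) x) (br00_skew (br z x) y) (br00_skew (br x y) z).
  apply: eq_scalar => phi; lin phi.
  rewrite (l3_cycle (d (theta x))) (l3_cycle (d (theta y))).
  rewrite (l3_cycle (d (theta z))).
  (* The condition on [l3] is a linear combination of [theta] applied to [jacobi0] and of the three
     cyclic instances of [jacobi1]. *)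
  have := congr1 (phi \o theta) (jacobi0 x y z).
  have := congr1 phi (ac_br x y (theta z)).
  have := congr1 phi (ac_br y z (theta x)).
  have := congr1 phi (ac_br z x (theta y)).
  by rewrite /=; lin phi; lra.
Qed.

Lemma skew2_partial (tau : 'Hom(g0, g1)) : skew2 (t2 (partial tau)).
Proof.
split=> [y a x x'|x a y y'|x y]; rewrite /= /br10.
- by apply: eq_scalar => phi; lin phi; ring.
- by apply: eq_scalar => phi; lin phi; ring.
- rewrite (br00_skew x y) (ac_dmap (tau y)).
  by apply: eq_scalar => phi; lin phi; ring.
Qed.

(** Both [1 + d tau] and [1 + tau d] turn [star] into composition, so a [star]-inverse of [tau]
    yields the inverse maps. *)
Lemma autm1_bij (tau : 'Hom(g0, g1)) : is_autm1 tau ->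
  bijective (t0 (partial tau)) /\ bijective (t1 (partial tau)).
Proof.
move=> [tau' [h h']]; split.
- exists (t0 (partial tau')) => x /=; apply: eq_scalar => phi.
  + have := congr1 (fun f : 'Hom(g0, g1) => phi (d (f x))) h'.
    by rewrite /star /= zero_lfunE; lin phi; rewrite !linear0; lra.
  + have := congr1 (fun f : 'Hom(g0, g1) => phi (d (f x))) h.
    by rewrite /star /= zero_lfunE; lin phi; rewrite !linear0; lra.
- exists (t1 (partial tau')) => x /=; apply: eq_scalar => phi.
  + have := congr1 (fun f : 'Hom(g0, g1) => phi (f (d x))) h'.
    by rewrite /star /= zero_lfunE; lin phi; rewrite !linear0; lra.
  + have := congr1 (fun f : 'Hom(g0, g1) => phi (f (d x))) h.
    by rewrite /star /= zero_lfunE; lin phi; rewrite !linear0; lra.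
Qed.

Lemma is_aut0_partial (tau : 'Hom(g0, g1)) :
  is_autm1 tau -> is_aut0 (partial tau).
Proof.
move=> tau_unit; split; first exact: autm1_bij.
- split; last exact: skew2_partial.
  by apply/lfunP => x; rewrite /=; apply: eq_scalar => phi; lin phi.
- move=> x y; rewrite /= /br10; apply: eq_scalar => phi; lin phi.
  rewrite !dmap_br (br00_skew y (d _)) (br00_skew (d (tau y)) (d (tau x))).
  by lin phi; ring.
- move=> x a; rewrite /= /br10; apply: eq_scalar => phi; lin phi.
  by rewrite dmap_br (ac_dmap a) (ac_dmap (tau (d a))); lin phi; lra.
- move=> x y z; rewrite /= /br10; apply: eq_scalar => phi; lin phi.
  have := congr1 (phi \o tau) (jacobi0 x y z).
  have D1 (u v w : g0) := congr1 phi (ac_br u v (tau w)).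
  (* This is [jacobi1] at [u], [d (tau v)], [tau w], its left side rewritten by [dmap_br] and
     [br_dmap]. Sorted by degree in [tau], [jacobi0] and [D1] serve the linear terms, three
     instances of [D2] the quadratic ones, and [D2] at [u = d (tau z)] the cubic ones. *)
  have D2 (u v w : g0) : phi (- ac (d (tau w)) (ac u (tau v))) =
      phi (ac u (ac (d (tau v)) (tau w)) - ac (d (tau v)) (ac u (tau w))
           - l3 g u (d (tau v)) (d (tau w))).
    by rewrite -ac_dmap dmap_br ac_br.
  move: (D1 x y z) (D1 y z x) (D1 z x y) (D2 z y x) (D2 x z y) (D2 y x z).
  move: (D2 (d (tau z)) y x).
  set a := d (tau x); set b := d (tau y); set c := d (tau z).
  (* One argument order is fixed for each [l3] term, so that [lra] sees equal terms as the same
     atom. *)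
  rewrite -(l3_cycle a y z) (l3_cycle z x b) (l3_cycle z b a) (l3_cycle c b a).
  rewrite (l3_skew12 a b z) (l3_skew12 a b c) (l3_skew12 a y c) (l3_skew23 x b c).
  rewrite (ac_dmap (tau z) (tau x) : ac c _ = - ac a _).
  rewrite /=; lin phi.
  lra.
Qed.
End Algebra.

(** * Binomial sums, powers of an endomorphism and convergence of its exponential *)

Lemma inv_fact_bin (F : numFieldType) (n i : nat) : (i <= n)%N ->
  (i`!%:R)^-1 * ((n - i)`!%:R)^-1 = (n`!%:R)^-1 * 'C(n, i)%:R :> F.
Proof.
move=> le_in; rewrite -(bin_fact le_in) !natrM.
have nz m : m`!%:R != 0 :> F by rewrite pnatr_eq0 -lt0n fact_gt0.
have nzC : 'C(n, i)%:R != 0 :> F by rewrite pnatr_eq0 -lt0n bin_gt0.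
by field; rewrite nzC !nz.
Qed.

(** The induction step of a binomial expansion: a Leibniz rule sends the term of index [(i, j)] to
    those of index [(i + 1, j)] and [(i, j + 1)]. *)
Lemma sum_pascal (V : nmodType) (F : nat -> nat -> V) (n : nat) :
  \sum_(i < n.+1) (F i.+1 (n - i)%N + F i (n - i).+1) *+ 'C(n, i) =
  \sum_(i < n.+2) F i (n.+1 - i)%N *+ 'C(n.+1, i).
Proof.
under eq_bigr => i _ do rewrite mulrnDl.
rewrite big_split /= [RHS]big_ord_recl /= bin0 subn0 mulr1n.
under [in RHS]eq_bigr => i _ do
  rewrite (_ : bump 0 i = i.+1) // subSS binS mulrnDr.
rewrite [in RHS]big_split /= [RHS]addrA [RHS]addrC; congr (_ + _).
rewrite [in RHS]big_ord_recr /= bin_small // mulr0n addr0 big_ord_recl /= bin0.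
rewrite subn0 mulr1n; congr (_ + _); apply: eq_bigr => i _.
by rewrite (_ : bump 0 i = i.+1) // subnSK.
Qed.

Local Arguments end_pow : simpl never.

Section EndPow.
Variables (R : realType) (V : vectType R) (X : 'End(V)).

Lemma end_powS n v : end_pow X n.+1 v = X (end_pow X n v).
Proof. by rewrite /end_pow iterS comp_lfunE. Qed.

Lemma end_pow0 v : end_pow X 0 v = v.
Proof. by rewrite /end_pow /= id_lfunE. Qed.

Lemma end_powD m n v : end_pow X (m + n) v = end_pow X m (end_pow X n v).
Proof.
by elim: m => [|m IH]; rewrite ?addSn ?end_powS ?IH // add0n end_pow0.
Qed.

Lemma end_powSr n v : end_pow X n.+1 v = end_pow X n (X v).
Proof. by rewrite -addn1 end_powD end_powS end_pow0. Qed.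

End EndPow.

(** Evaluation is named so that it can carry a linear structure, which lets series of maps be
    evaluated termwise. *)
Definition lfun_eval (R : realType) (U V : vectType R) (x : U)
  (f : 'Hom(U, V)) : V := f x.

Section Linearity.
Variables (R : realType) (U V W : vectType R).

Fact lfun_eval_is_linear (x : U) : linear (@lfun_eval R U V x).
Proof. by move=> a f h; rewrite /lfun_eval add_lfunE scale_lfunE. Qed.

Fact comp_lfun_is_linear (f : 'Hom(V, W)) :
  linear (comp_lfun f : 'Hom(U, V) -> 'Hom(U, W)).
Proof. by move=> a h k; rewrite comp_lfunDr comp_lfunZr. Qed.

HB.instance Definition _ (x : U) :=
  GRing.isLinear.Build R 'Hom(U, V) V _ (@lfun_eval R U V x)
    (lfun_eval_is_linear x).

HB.instance Definition _ (f : 'Hom(V, W)) :=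
  GRing.isLinear.Build R 'Hom(U, V) 'Hom(U, W) _ (@comp_lfun R U V W f)
    (comp_lfun_is_linear f).

Lemma vsums_eval (u : nat -> 'Hom(U, V)) (s : 'Hom(U, V)) (x : U) :
  vsums u s -> vsums (fun n => u n x) (s x).
Proof. exact: (vsums_linear (f := lfun_eval x)). Qed.

Lemma vabs_eval (u : nat -> 'Hom(U, V)) (x : U) :
  vabs u -> vabs (fun n => u n x).
Proof. exact: (vabs_linear (f := lfun_eval x)). Qed.

End Linearity.
Arguments vsums_eval {R U V u s} x _.
Arguments vabs_eval {R U V u} x _.

Section ExpEnd.
Variables (R : realType) (V : vectType R) (X : 'End(V)).

(** [end_pow X n] is the n-th iterate of left composition with [X], applied to the identity, so
    [vabs_exp] applies in ['End(V)]. *)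
Lemma vabs_exp_end : vabs (exp_end_term X).
Proof.
apply: (vabs_exp (f := comp_lfun X) (c := fun n => (n`!%:R)^-1)) => n.
by rewrite ger0_norm ?invr_ge0.
Qed.

Lemma vsums_exp_end : vsums (exp_end_term X) (exp_end X).
Proof. exact: vsums_vseriesE vabs_exp_end. Qed.

End ExpEnd.
Arguments vabs_exp_end {R V} X.
Arguments vsums_exp_end {R V} X.

(** * The exponential of [theta] and the series for [e^l] *)

(** Grouping by [p = i + j] leaves the single value [k = m - p]. *)
Lemma exp_l_sum (R : realType) (g : lie2alg R) (X : triple g) (x y : deg0 g) m :
  \sum_(i < m.+1) \sum_(j < m.+1) \sum_(k < m.+1 | (i + j + k == m)%N)
    'C(i + j, i)%:R *:
      end_pow (t1 X) k (t2 X (end_pow (t0 X) i x) (end_pow (t0 X) j y)) =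
  \sum_(p < m.+1) end_pow (t1 X) (m - p) (\sum_(j < p.+1)
    t2 X (end_pow (t0 X) (p - j) x) (end_pow (t0 X) j y) *+ 'C(p, j)).
Proof.
rewrite exchange_big /=.
pose G j i := 'C(i + j, i)%:R *: end_pow (t1 X) (m - (i + j))
  (t2 X (end_pow (t0 X) i x) (end_pow (t0 X) j y)).
transitivity (\sum_(j < m.+1) \sum_(i < m.+1 | (j + i < m.+1)%N) G j i).
  apply: eq_bigr => j _; rewrite [RHS]big_mkcond; apply: eq_bigr => i _.
  rewrite [in RHS]addnC; case: ifP => [ij|/negbT ij].
    rewrite (big_pred1 (Ordinal (leq_subr (i + j) m : m - (i + j) < m.+1)%N)) //.
    move=> k /=; rewrite -val_eqE /=; move: ij; rewrite ltnS => ij.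
    by rewrite -(eqn_add2l (i + j) k) subnKC.
  rewrite big_pred0 // => k; apply: contraNF ij => /eqP E.
  by rewrite ltnS -[leqRHS]E leq_addr.
rewrite -(sum_antidiagonal G); apply: eq_bigr => p _.
rewrite linear_sum; apply: eq_bigr => j _.
have jp : (j <= p)%N by rewrite -ltnS.
by rewrite /G subnK // bin_sub // scaler_nat linearMn.
Qed.

Section Exponentials.
Variables (R : realType) (g : lie2alg R) (theta : derm1 g).
Local Notation g0 := (deg0 g).
Local Notation g1 := (degm1 g).
Local Notation d := (dmap g).
Local Notation br := (br00 g).
Local Notation ac := (br01 g).
Local Notation X0 := (d \o theta)%VF.
Local Notation X1 := (theta \o d)%VF.

(* [expm1 theta] is the sum over [n >= 0] of [expm1_num theta n / n!]. *)
Definition expm1_num (n : nat) : 'Hom(g0, g1) :=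
  if n is m.+1 then (end_pow X1 m \o theta)%VF else 0.

Local Arguments expm1_num : simpl never.

Lemma expm1_numE n x : expm1_num n.+1 x = end_pow X1 n (theta x).
Proof. exact: comp_lfunE. Qed.

Lemma expm1_numS n x : X1 (expm1_num n.+1 x) = expm1_num n.+2 x.
Proof. by rewrite !expm1_numE end_powS. Qed.

Lemma end_pow_num i n x :
  end_pow X1 i (expm1_num n.+1 x) = expm1_num (i + n.+1) x.
Proof. by rewrite addnS !expm1_numE end_powD. Qed.

(** Both sides are the same alternating word in [d] and [theta]. The exponent starts at 1: at 0 the
    power is the identity while [expm1_num] is 0. *)
Lemma dmap_num n x : end_pow X0 n.+1 x = d (expm1_num n.+1 x).
Proof.
elim: n => [|n IH]; first by rewrite end_powS !end_pow0 expm1_numE end_pow0 comp_lfunE.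
by rewrite end_powS IH -expm1_numS !comp_lfunE.
Qed.

Lemma num_dmap n a : end_pow X1 n.+1 a = expm1_num n.+1 (d a).
Proof. by rewrite end_powSr expm1_numE comp_lfunE. Qed.

Lemma exp_l_closed x y m :
  \sum_(p < m.+1) end_pow X1 (m - p) (\sum_(j < p.+1)
    t2 (dbar theta) (end_pow X0 (p - j) x) (end_pow X0 j y) *+ 'C(p, j)) =
  expm1_num m.+1 (br x y) - ac x (expm1_num m.+1 y) +
  \sum_(i < m.+2) ac (end_pow X0 i y) (expm1_num (m.+1 - i) x) *+ 'C(m.+1, i).
Proof.
elim: m => [|m IH].
  rewrite !big_ord_recl !big_ord0 /end_pow /expm1_num /= /br10.
  rewrite !comp_lfunE !id_lfunE zero_lfunE.
  by rewrite !bin0 linear0 mul0rn !mulr1n !addr0 opprK.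
rewrite big_ord_recr /= subnn end_pow0.
(* The rows [p <= m] are [X1] of the sum for [m]; the row [p = m + 1] is new. *)
transitivity (X1 (\sum_(p < m.+1) end_pow X1 (m - p) (\sum_(j < p.+1)
    t2 (dbar theta) (end_pow X0 (p - j) x) (end_pow X0 j y) *+ 'C(p, j))) +
  \sum_(j < m.+2) t2 (dbar theta) (end_pow X0 (m.+1 - j) x) (end_pow X0 j y)
    *+ 'C(m.+1, j)).
  congr (_ + _); rewrite linear_sum; apply: eq_bigr => p _.
  by rewrite subSn ?end_powS // -ltnS.
rewrite {}IH -(sum_pascal (fun i j => ac (end_pow X0 i y) (expm1_num j x)) m.+1).
(* [t2 (dbar theta)] corrects the failure of [X1] to be a derivation of the action, which gives the
   Leibniz rule that [sum_pascal] needs. It applies to the new row for [j < n], where [X0^(n-j) x]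
   lies in the image of [d]; at [j = n] only the second argument does, whence [T2]. *)
have T1 (a : g1) (y' : g0) : t2 (dbar theta) (d a) y' + X1 (ac y' a) =
    ac (X0 y') a + ac y' (X1 a).
  rewrite /= /br10 (br00_skew y') -dmap_br (ac_dmap a).
  by apply: eq_scalar => phi; lin phi; ring.
have T2 (b : g1) : t2 (dbar theta) x (d b) =
    X1 (ac x b) - ac x (X1 b) + ac (d b) (theta x).
  by rewrite /= /br10 opprK -dmap_br !comp_lfunE.
set n := m.+1; move: (t2 (dbar theta)) T1 T2 => T T1 T2.
have S1 : \sum_(j < n) T (end_pow X0 (n - j) x) (end_pow X0 j y)
      *+ 'C(n, j) +
    X1 (\sum_(j < n) ac (end_pow X0 j y) (expm1_num (n - j) x) *+ 'C(n, j)) =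
    \sum_(j < n) (ac (end_pow X0 j.+1 y) (expm1_num (n - j) x) +
       ac (end_pow X0 j y) (expm1_num (n - j).+1 x)) *+ 'C(n, j).
  rewrite linear_sum -big_split; apply: eq_bigr => j _ /=.
  rewrite linearMn -mulrnDl; congr (_ *+ _).
  rewrite -(subnSK (ltn_ord j)) dmap_num T1 -expm1_numS.
  by rewrite end_powS.
(* In the summand [i = n] the half containing [expm1_num 0] vanishes; the other half is the last
   term of [T2]. *)
rewrite [X in _ = _ + X]big_ord_recr /=. rewrite -S1 subnn binn !mulr1n.
rewrite [in X in X1 X]big_ord_recr [in X in _ + X]big_ord_recr /=.
rewrite subnn binn !mulr1n zero_lfunE !linear0 !end_pow0 addr0 add0r.
rewrite {1 3}/n dmap_num T2 -/n -!expm1_numS /=.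
apply: eq_scalar => phi; lin phi; rewrite ?end_pow0; ring.
Qed.

(** The series of [expm1 theta] started at [n = 0] with a zero term, so that its factorials align
    with those of [exp_end] in Cauchy products. *)
Definition expm1_nterm (n : nat) : 'Hom(g0, g1) := (n`!%:R)^-1 *: expm1_num n.

Lemma vabs_expm1 : vabs (expm1_term theta).
Proof.
have E n : expm1_term theta n = (n.+1`!%:R)^-1 *: iter n (comp_lfun X1) theta.
  rewrite /expm1_term; congr (_ *: _). apply/lfunP => x; rewrite comp_lfunE.
  by elim: n => [|n IH]; rewrite ?end_pow0 // end_powS IH iterS [RHS]comp_lfunE.
move=> phi; under [fun n => phi _]funext => n do rewrite E.
apply: (vabs_exp (f := comp_lfun X1) (c := fun n => (n.+1`!%:R)^-1)) => n.
rewrite ger0_norm ?invr_ge0 // lef_pV2 ?posrE ?ltr0n ?fact_gt0 //.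
by rewrite ler_nat factS leq_pmull.
Qed.

Lemma vabs_nterm : vabs expm1_nterm.
Proof. exact: (vabs_shift vabs_expm1). Qed.

Lemma vsums_nterm : vsums expm1_nterm (expm1 theta).
Proof.
apply/vsums_shift; rewrite /expm1_nterm scaler0 subr0.
exact: vsums_vseriesE vabs_expm1.
Qed.

(** After the constant term [x] the two series agree termwise by [dmap_num]. *)
Lemma exp_end0E x : exp_end X0 x = x + d (expm1 theta x).
Proof.
have := vsums_eval x (vsums_exp_end X0) => /vsums_shift.
rewrite /exp_end_term /= invr1 scale1r end_pow0 => h0.
have h1 := vsums_linear (f := d) (vsums_eval x vsums_nterm).
move/vsums_shift: h1; rewrite /expm1_nterm scaler0 zero_lfunE linear0 subr0.
move=> h1; apply/eqP; rewrite addrC -subr_eq; apply/eqP.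
apply: vsums_unique h0 _; apply: eq_vsums h1 => n.
by rewrite !scale_lfunE dmap_num linearZ.
Qed.

Lemma exp_end1E a : exp_end X1 a = a + expm1 theta (d a).
Proof.
have := vsums_eval a (vsums_exp_end X1) => /vsums_shift.
rewrite /exp_end_term /= invr1 scale1r end_pow0 => h0.
have /vsums_shift h1 := vsums_eval (d a) vsums_nterm.
move: h1; rewrite /expm1_nterm scaler0 zero_lfunE subr0.
move=> h1; apply/eqP; rewrite addrC -subr_eq; apply/eqP.
apply: vsums_unique h0 _; apply: eq_vsums h1 => n.
by rewrite !scale_lfunE num_dmap.
Qed.

Lemma vsums_exp_l x y :
  vsums (exp_l_term (dbar theta) x y) (t2 (partial (expm1 theta)) x y).
Proof.
(* For [n >= 1], [w n] is the closed form of the term of index [n - 1]; including [n = 0], where it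
   vanishes, makes its last sum a full Cauchy product. *)
pose w n := expm1_nterm n (br x y) - ac x (expm1_nterm n y) +
  \sum_(i < n.+1) ac (exp_end_term X0 i y) (expm1_nterm (n - i) x).
have hw : vsums w (t2 (partial (expm1 theta)) x y).
  (* With [tau = expm1 theta], the terms in [[tau x, y]] and [[tau x, d (tau y)]] merge into the
     action of [e^X0 y = y + d (tau y)] on [tau x]. *)
  have -> : t2 (partial (expm1 theta)) x y = expm1 theta (br x y) -
      ac x (expm1 theta y) + ac (exp_end X0 y) (expm1 theta x).
    rewrite exp_end0E /= /br10 opprK; apply: eq_scalar => phi; lin phi.
    by rewrite opprK addrA.
  apply: vsumsD.
    apply: vsumsB; first exact: vsums_eval _ vsums_nterm.
    exact: vsums_linear (vsums_eval y vsums_nterm).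
  apply: (vsums_bilinear (B := ac) (u := fun n => exp_end_term X0 n y)
    (v := fun n => expm1_nterm n x)).
  - exact: vabs_eval _ (vabs_exp_end X0).
  - exact: vabs_eval _ vabs_nterm.
  - exact: vsums_eval _ (vsums_exp_end X0).
  - exact: vsums_eval _ vsums_nterm.
have w0 : w 0%N = 0.
  rewrite /w big_ord_recl big_ord0 /expm1_nterm scaler0 !zero_lfunE.
  by rewrite !linear0 !addr0.
move/vsums_shift: hw; rewrite w0 subr0; apply: eq_vsums => m.
rewrite /exp_l_term exp_l_sum exp_l_closed /w /expm1_nterm !scale_lfunE linearZ.
rewrite /= -scalerBr [RHS]scalerDr; congr (_ + _).
rewrite scaler_sumr; apply: eq_bigr => i _.
rewrite /exp_end_term !scale_lfunE !lfun_linearE scale_lfunE scalerA mulrC.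
by rewrite inv_fact_bin -?scalerA ?scaler_nat // -ltnS.
Qed.

End Exponentials.
Arguments vabs_expm1 {R g} theta.
Arguments vabs_nterm {R g} theta.
Arguments vsums_nterm {R g} theta.
Arguments vsums_exp_l {R g} theta x y.

(** * Invertibility of [expm1 theta] for [star] *)

Lemma expm1_numN (R : realType) (g : lie2alg R) (theta : derm1 g) n :
  expm1_num (- theta) n = (-1) ^+ n *: expm1_num theta n.
Proof.
case: n => [|n]; first by rewrite scaler0.
have E a : end_pow (- theta \o dmap g)%VF n a =
    (-1) ^+ n *: end_pow (theta \o dmap g)%VF n a.
  elim: n => [|n IH]; first by rewrite scale1r !end_pow0.
  rewrite !end_powS IH !comp_lfunE opp_lfunE exprS mulN1r scaleNr.
  by rewrite !lfun_linearE.
apply/lfunP => x; rewrite scale_lfunE !expm1_numE E opp_lfunE linearN.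
by rewrite exprS mulN1r scaleNr scalerN.
Qed.

(** As [e^X1 = 1 + e^theta d], the claim says that [e^X1] composed with [e^(- theta)] is
    [- e^theta]. The Cauchy product reduces it to the vanishing of [(-1 + 1)^n] for [n >= 1]. *)
Lemma star_expm1N (R : realType) (g : lie2alg R) (theta : derm1 g) :
  star (expm1 theta) (expm1 (- theta)) = 0.
Proof.
pose X1 := (theta \o dmap g)%VF.
apply/lfunP => x; rewrite zero_lfunE /star !add_lfunE !comp_lfunE.
rewrite -addrA -exp_end1E; apply/eqP; rewrite addrC addr_eq0; apply/eqP.
(* The identity of ['End('End(degm1 g))], read as a curried map, is the bilinear evaluation of an
   endomorphism at a vector. *)
have h : vsums (fun n => \sum_(i < n.+1) (\1%VF : 'End('End(degm1 g)))
    (exp_end_term X1 i) (expm1_nterm (- theta) (n - i) x))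
    (exp_end X1 (expm1 (- theta) x)).
  rewrite -[exp_end X1 in X in vsums _ X](id_lfunE (exp_end X1)).
  apply: (vsums_bilinear (B := \1%VF : 'End('End(degm1 g)))
    (u := exp_end_term X1) (v := fun n => expm1_nterm (- theta) n x));
    [exact: vabs_exp_end | | exact: vsums_exp_end |].
  - exact: vabs_eval _ (vabs_nterm _).
  - exact: vsums_eval _ (vsums_nterm _).
have h' := vsums_linear (f := -%R) (vsums_eval x (vsums_nterm theta)).
apply: vsums_unique h _; apply: eq_vsums h' => n /=.
have E (i : 'I_n.+1) : (\1%VF : 'End('End(degm1 g)))
    (exp_end_term X1 i) (expm1_nterm (- theta) (n - i) x) =
    (n`!%:R)^-1 *: (((-1) ^+ (n - i) * 'C(n, i)%:R) *:
      end_pow X1 i (expm1_num theta (n - i) x)).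
  rewrite id_lfunE /expm1_nterm /exp_end_term expm1_numN.
  rewrite !scale_lfunE !lfun_linearE !scalerA; congr (_ *: _).
  by rewrite mulrA inv_fact_bin -1?ltnS // -mulrA [_ * (-1) ^+ _]mulrC.
rewrite (eq_bigr _ (fun i _ => E i)) -scaler_sumr /expm1_nterm scale_lfunE -scalerN.
(* The summand [i = n] vanishes because [expm1_num theta 0] is 0; its missing coefficient 1 is what
   makes the others add up to -1. *)
congr (_ *: _); rewrite big_ord_recr /= subnn zero_lfunE linear0 scaler0 addr0.
case: n {E} => [|n]; first by rewrite big_ord0 zero_lfunE oppr0.
transitivity (\sum_(i < n.+1) ((-1) ^+ (n.+1 - i) * 'C(n.+1, i)%:R) *:
    expm1_num theta n.+1 x : degm1 g); last first.
  apply: eq_bigr => i _; congr (_ *: _).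
  by rewrite -(subnSK (ltn_ord i)) end_pow_num addnS subnKC // -ltnS.
rewrite -scaler_suml -scaleN1r; congr (_ *: _).
have := exprDn (-1 : R) 1 n.+1; rewrite addNr expr0n big_ord_recr /=.
rewrite subnn binn expr1n mulr1 mulr1n => /esym/eqP; rewrite addr_eq0 => /eqP E.
rewrite -[LHS]E.
by apply: eq_bigr => i _; rewrite expr1n mulr1 mulr_natr.
Qed.

Lemma is_autm1_expm1 (R : realType) (g : lie2alg R) (theta : derm1 g) :
  is_autm1 (expm1 theta).
Proof.
exists (expm1 (- theta)); split; first exact: star_expm1N.
by rewrite -{2}(opprK theta) star_expm1N.
Qed.

Theorem lemma5p6 (R : realType) (g : lie2alg R) (theta : derm1 g) :
  [/\ expm1_cvg theta /\ is_autm1 (expm1 theta),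
      is_der0 (dbar theta),
      exp0_cvg (dbar theta) /\ is_aut0 (exp0 (dbar theta)) &
      partial (expm1 theta) = exp0 (dbar theta)].
Proof.
(* The equality comes first, since it transports the automorphism property from [partial] of a unit
   to [exp0 (dbar theta)]. *)
have eq_exp : partial (expm1 theta) = exp0 (dbar theta).
  rewrite /partial /exp0; congr Triple.
  - by apply/lfunP => x; rewrite add_lfunE id_lfunE comp_lfunE exp_end0E.
  - by apply/lfunP => a; rewrite add_lfunE id_lfunE comp_lfunE exp_end1E.
  - apply/funext => x; apply/funext => y.
    by have [_ ->] := vsums_vseries (vsums_exp_l theta x y).
have autm1 := is_autm1_expm1 theta.
split; [split=> // | exact: is_der0_dbar | split | exact: eq_exp].
- by have [] := vsums_vseries (vsums_vseriesE (vabs_expm1 theta)).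
- split=> [||x y].
  + by have [] := vsums_vseries (vsums_exp_end (t0 (dbar theta))).
  + by have [] := vsums_vseries (vsums_exp_end (t1 (dbar theta))).
  + by have [] := vsums_vseries (vsums_exp_l theta x y).
- by rewrite -eq_exp; exact: is_aut0_partial.
Qed.
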